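(* In the comparison query model, every deterministic or randomized online algorithm for finding the $B$-optimal stable matching in a stable matching instance with one-sided uncertainty has competitive ratio $\Omega(n)$.
   Context: Two disjoint sets $A$, $B$ of agents with $|A|=|B|=n$. Each $a\in A$ has a strict total order $\prec_a$ on $B$ and each $b\in B$ has a strict total order $\prec_b$ on $A$ ($x\prec_y z$: $y$ prefers $x$ to $z$). A matching is a bijection between $A$ and $B$; it is stable if there is no pair $(a,b)$, $b\neq M(a)$, with $a$ preferring $b$ to $M(a)$ and $b$ preferring $a$ to $M(b)$. A stable matching is $B$-optimal if every agent of $B$ weakly prefers its partner in it to its partner in any other stable matching. One-sided uncertainty: the orders $\prec_a$ ($a\in A$) are known, the orders $\prec_b$ ($b\in B$) are unknown and learned only via queries. A comparison query $\mathit{prefer}(b,a_1,a_2)$ returns whichever of $a_1,a_2$ agent $b$ prefers. An online algorithm queries adaptively until the known information proves its output correct (for every $B$-side preference profile consistent with the $A$-side preferences and the answers). Its competitive ratio is the supremum over instances of the ratio between its number of queries (expected number, for randomized algorithms) and the minimum size of a query set whose answers on that instance suffice to prove the correct output. *)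

(* Defs.v *)
From HB Require Import structures.
From mathcomp Require Import all_boot all_order all_algebra.
From mathcomp Require Import all_classical all_reals all_analysis.

Set Implicit Arguments.
Unset Strict Implicit.
Unset Printing Implicit Defensive.

Import Order.TTheory GRing.Theory Num.Theory.

Local Open Scope classical_set_scope.
Local Open Scope ring_scope.

(* Strict total orders; [prefers p x y] reads "x is preferred to y". *)
Record pref (T : finType) := Pref {
  prefers :> rel T;
  pref_irr : irreflexive prefers;
  pref_trans : transitive prefers;
  pref_total : forall x y : T, x != y -> prefers x y || prefers y x
}.

(* The two sides are separate types [A] and [B], hence disjoint. *)
Record matching (A B : finType) := Matching {
  partnerA : A -> B;
  partnerB : B -> A;
  partnerAK : cancel partnerA partnerB;
  partnerBK : cancel partnerB partnerA
}.

Section StableMatching.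
Variables A B : finType.

Definition stable (pA : A -> pref B) (pB : B -> pref A) (M : matching A B) :=
  ~ exists a b, [/\ b != partnerA M a,
                    pA a b (partnerA M a) & pB b a (partnerB M b)].

Definition B_optimal (pA : A -> pref B) (pB : B -> pref A) (M : matching A B) :=
  stable pA pB M /\
  forall M', stable pA pB M' ->
  forall b, partnerB M b = partnerB M' b \/ pB b (partnerB M b) (partnerB M' b).

(* [(b, a1, a2)] stands for the query prefer(b, a1, a2). *)
Definition query := (B * A * A)%type.

Definition answer (pB : B -> pref A) (q : query) : A :=
  let: (b, a1, a2) := q in if pB b a1 a2 then a1 else a2.

(* The answers under [pB] to the queries in [Q] prove that [M] is B-optimal. *)
Definition proves (pA : A -> pref B) (pB : B -> pref A) (Q : pred query)
    (M : matching A B) :=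
  forall pB' : B -> pref A,
    (forall q, Q q -> answer pB' q = answer pB q) -> B_optimal pA pB' M.

(* The default value [#|query|] is the size of the set of all queries, so it
   never undercuts a genuine query set. *)
Definition opt (pA : A -> pref B) (pB : B -> pref A) : nat :=
  \big[minn/#|{: query}|]_(Q : {set query} |
      `[< exists M, proves pA pB (mem Q) M >]) #|Q|.

(* Adaptive query strategies: the continuation of [Ask] receives the agent
   returned by the query. *)
Inductive strategy :=
| Output of matching A B
| Ask of query & (A -> strategy).

Fixpoint queries (t : strategy) (pB : B -> pref A) : seq query :=
  match t with
  | Output _ => [::]
  | Ask q next => q :: queries (next (answer pB q)) pB
  end.

Fixpoint output (t : strategy) (pB : B -> pref A) : matching A B :=
  match t with
  | Output M => M
  | Ask q next => output (next (answer pB q)) pB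
  end.

(* The A-side preferences are the input known at the start. *)
Definition algorithm := (A -> pref B) -> strategy.

Definition finds_B_optimal (alg : algorithm) :=
  forall pA pB, proves pA pB (mem (queries (alg pA) pB)) (output (alg pA) pB).

Definition num_queries (alg : algorithm) (pA : A -> pref B) (pB : B -> pref A)
  : nat := size (queries (alg pA) pB).

(* Instances solvable without any query, for which the ratio is undefined, are
   left out of the supremum. *)
Definition competitive_ratio (R : realType)
    (cost : (A -> pref B) -> (B -> pref A) -> \bar R) : \bar R :=
  ereal_sup [set r | exists pA pB, (0 < opt pA pB)%N /\
                       r = (cost pA pB * ((opt pA pB)%:R^-1)%:E)%E].

Definition det_cost (R : realType) (alg : algorithm) pA pB : \bar R :=
  ((num_queries alg pA pB)%:R)%:E.

(* A randomized algorithm is a random deterministic one, driven by a seed in a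
   probability space. *)
Record randomized_algorithm (d : measure_display) (Omega : measurableType d)
    (R : realType) := RandomizedAlgorithm {
  seeded :> Omega -> algorithm;
  seeded_measurable : forall pA pB,
    measurable_fun [set: Omega] (fun w => (num_queries (seeded w) pA pB)%:R : R)
}.

Definition expected_cost (d : measure_display) (Omega : measurableType d)
    (R : realType) (P : probability Omega R)
    (alg : randomized_algorithm Omega R) pA pB : \bar R :=
  'E_P[fun w => (num_queries (alg w) pA pB)%:R].

End StableMatching.

(* Main.v *)
Require Import Defs.
From HB Require Import structures.
From mathcomp Require Import all_boot all_order all_algebra perm.
From mathcomp Require Import all_classical all_reals all_analysis.
From mathcomp Require Import measurable_realfun zify.

Set Implicit Arguments.
Unset Strict Implicit.
Unset Printing Implicit Defensive.

Import Order.TTheory GRing.Theory Num.Theory.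

Local Open Scope classical_set_scope.
Local Open Scope ring_scope.

(* Agents are d_0, d_k (fillers, 1 <= k <= K), a_i (seekers) and e_i (rivals,
   1 <= i <= m) in A, with partners c_0, c_k, b_i, f_i in B, and n = 1 + K + 2m;
   the function g from [1, m] to [1, K] is hidden from the algorithm.
     d_k : c_k > c_0 > rest                  c_0 : d_0 is last
     a_i : b_i > c_1, ..., c_K > f_i > rest  c_k : {a_i | g i = k} > d_k > rest
     e_i : f_i > b_i > c_0 > rest            b_i : e_i > a_i > rest
                                             f_i : a_i > e_i > rest
   The matching with these partners is the only stable one, and O(n) queries prove
   it: once each B-agent is known to prefer its partner to d_0, d_0 must stay with
   c_0; as c_0 puts d_0 last, c_0 blocks any d_k leaving c_k; as c_(g i) is then
   held by d_(g i) but prefers a_i, a_i cannot leave b_i, and neither can e_i leave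
   f_i because of c_0.
   Conversely, as long as the pair (c_(g i), a_i) is not queried, c_(g i) may
   prefer d_(g i) to a_i, and then swapping a_i and e_i is stable and better for
   b_i. So an algorithm must find g i among K candidates for each i; for a
   uniformly random g this takes (K + 1) / 2 queries touching a_i on average, hence
   m (K + 1) / 4 = Omega(n^2) queries overall. *)

(** * Preferences induced by rank functions *)

Section RankedPreference.
Local Open Scope nat_scope.
Variables (T : finType) (r : T -> nat).

Let ranked : rel T := fun x y =>
  (r x < r y) || (r x == r y) && (enum_rank x < enum_rank y).

Let ranked_irr : irreflexive ranked.
Proof. by move=> x; rewrite /ranked !ltnn andbF. Qed.

Let ranked_trans : transitive ranked.
Proof. by move=> y x z; rewrite /ranked; lia. Qed.

Let ranked_total x y : x != y -> ranked x y || ranked y x.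
Proof.
move=> xy; have : enum_rank x != enum_rank y :> nat.
  by apply: contra_neq xy => /val_inj /enum_rank_inj.
by rewrite /ranked; lia.
Qed.

Definition pref_of_rank : pref T := Pref ranked_irr ranked_trans ranked_total.

Lemma pref_of_rank_lt x y : r x < r y -> pref_of_rank x y.
Proof. by rewrite /pref_of_rank /= /ranked => ->. Qed.

Lemma pref_of_rank_le x y : pref_of_rank x y -> r x <= r y.
Proof. by rewrite /pref_of_rank /= /ranked; lia. Qed.

End RankedPreference.

Lemma pref_of_rank_eq (T : finType) (r r' : T -> nat) x y :
  r x = r' x -> r y = r' y -> pref_of_rank r x y = pref_of_rank r' x y.
Proof. by rewrite /pref_of_rank /= => -> ->. Qed.

(* Keeps [/=] from unfolding the preferences of the instance. *)
Opaque pref_of_rank.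

Lemma pref_asym (T : finType) (p : pref T) x y : p x y -> p y x -> False.
Proof. by move=> xy yx; have := pref_trans xy yx; rewrite pref_irr. Qed.

Lemma answer_transfer (A B : finType) (pB pB' : B -> pref A) b a1 a2 :
  a1 != a2 -> pB b a1 a2 -> answer pB' (b, a1, a2) = answer pB (b, a1, a2) ->
  pB' b a1 a2.
Proof. by rewrite /= => /eqP ne ->; case: ifP => // _ eq; case: ne. Qed.

(** * The hard family of instances *)

Section HardInstance.
Local Open Scope nat_scope.
Variables m K : nat.

(* An A-agent and its diagonal partner in B carry the same label; [None] is the
   label of d_0 and c_0. *)
Notation agent := (option ('I_K + ('I_m + 'I_m))).
Definition filler (k : 'I_K) : agent := Some (inl k).
Definition seeker (i : 'I_m) : agent := Some (inr (inl i)).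
Definition rival (i : 'I_m) : agent := Some (inr (inr i)).

(* Smaller is better; [pref_of_rank] breaks ties arbitrarily. *)
Definition rankA (s t : agent) : nat :=
  match s with
  | None => 0
  | Some (inl _) => if t == s then 0 else if t == None then 1 else 2
  | Some (inr (inl i)) =>
      if t == s then 0 else
      if t is Some (inl _) then 1 else if t == rival i then 2 else 3
  | Some (inr (inr i)) =>
      if t == s then 0 else if t == seeker i then 1 else
      if t == None then 2 else 3
  end.

(* [g i = None] means that no c_k ranks a_i above d_k. *)
Definition rankB (g : 'I_m -> option 'I_K) (t s : agent) : nat :=
  match t with
  | None => s == None
  | Some (inl k) =>
      if s is Some (inr (inl i)) then (if g i == Some k then 0 else 2)
      else if s == t then 1 else 2
  | Some (inr (inl i)) => if s == rival i then 0 else if s == t then 1 else 2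
  | Some (inr (inr i)) => if s == seeker i then 0 else if s == t then 1 else 2
  end.

(** The exception is d_0: its rank is constant, so any agent of B may come first for it. *)
Lemma rankA_top s t : rankA s t <= rankA s s -> s = None \/ t = s.
Proof.
case: s => [[k|[i|i]]|] /=; rewrite ?eqxx; last by left.
all: by case: t => [[?|[?|?]]|] /=; repeat (case: ifP => [/eqP|_]); auto.
Qed.

Lemma rankB_None g t : t != None -> rankB g t t < rankB g t None.
Proof. by case: t => [[k|[i|i]]|] //= _; rewrite ?eqxx //. Qed.

Variables (A B : finType) (hA : A -> agent) (kA : agent -> A).
Variables (hB : B -> agent) (kB : agent -> B).
Hypotheses (hAK : cancel hA kA) (kAK : cancel kA hA).
Hypotheses (hBK : cancel hB kB) (kBK : cancel kB hB).

Definition instA (x : A) : pref B := pref_of_rank (fun y => rankA (hA x) (hB y)).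
Definition instB g (y : B) : pref A :=
  pref_of_rank (fun x => rankB g (hB y) (hA x)).

Definition diagonal : matching A B.
Proof.
by apply: (@Matching A B (fun x => kB (hA x)) (fun y => kA (hB y))) => x;
  rewrite ?kAK ?kBK ?hAK ?hBK.
Defined.

Definition swapped (i : 'I_m) : matching A B.
Proof.
by apply: (@Matching A B (fun x => kB (tperm (seeker i) (rival i) (hA x)))
   (fun y => kA (tperm (seeker i) (rival i) (hB y)))) => x;
  rewrite ?kAK ?kBK tpermK ?hAK ?hBK.
Defined.

(** * A linear-size certificate for the diagonal matching *)

Definition certificate (g : 'I_m -> 'I_K) : {set query A B} :=
  ([set (y, kA (hB y), kA None) | y in B] :|:
   [set (kB None, x, kA None) | x in A] :|:
   [set (kB (filler (g i)), kA (seeker i), kA (filler (g i))) | i in 'I_m])%SET.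

Lemma card_certificate g : #|certificate g| <= #|B| + #|A| + m.
Proof.
apply: leq_trans (leq_card_setU _ _) _; apply: leq_add; last first.
  by rewrite (leq_trans (leq_imset_card _ _)) // card_ord.
apply: leq_trans (leq_card_setU _ _) _.
by apply: leq_add; apply: leq_imset_card.
Qed.

Lemma certificate_proves g :
  proves instA (instB (Some \o g)) (mem (certificate g)) diagonal.
Proof.
move=> pB agree.
have kA_inj := can_inj kAK; have kB_inj := can_inj kBK.
have own t : t != None -> pB (kB t) (kA t) (kA None).
  move=> t0; apply: answer_transfer; last first.
  - apply: agree; rewrite !inE; apply/orP; left; apply/orP; left.
    by apply/imsetP; exists (kB t); rewrite ?kBK.
  - by apply: pref_of_rank_lt; rewrite !kAK kBK rankB_None.
  - by rewrite (inj_eq kA_inj).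
have last0 t : t != None -> pB (kB None) (kA t) (kA None).
  move=> t0; apply: answer_transfer; last first.
  - apply: agree; rewrite !inE; apply/orP; left; apply/orP; right.
    by apply/imsetP; exists (kA t).
  - by apply: pref_of_rank_lt; rewrite !kAK kBK /= (negbTE t0).
  - by rewrite (inj_eq kA_inj).
have needle i : pB (kB (filler (g i))) (kA (seeker i)) (kA (filler (g i))).
  apply: answer_transfer; last first.
  - by apply: agree; rewrite !inE; apply/orP; right; apply/imsetP; exists i.
  - by apply: pref_of_rank_lt; rewrite !kAK kBK /= !eqxx.
  - by rewrite (inj_eq kA_inj).
split.
  (* Every agent of A other than d_0 holds its first choice, and no agent of B prefers d_0 to its
     partner. *)
  case=> x [y [ne]]; rewrite -[x]hAK -[y]hBK /= !kAK kBK.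
  move/pref_of_rank_le; rewrite !kAK !kBK => /rankA_top[xN|yx].
    rewrite xN; have [yN|/own] := eqVneq (hB y) None.
      by move: ne; rewrite /= xN -yN hBK eqxx.
    by move=> p q; apply: pref_asym p q.
  by move: ne; rewrite /= -yx hBK eqxx.
move=> M stM y; left; rewrite /= -[y in RHS]hBK.
(* [sg] reads [M] as a permutation of labels; once it is the identity, the diagonal is the only
   stable matching. *)
pose sg s := hB (partnerA M (kA s)).
have sgE s : partnerA M (kA s) = kB (sg s) by rewrite hBK.
have sg_inj : injective sg.
  move=> s t /(can_inj hBK) e; apply: kA_inj.
  by rewrite -[kA s](partnerAK M) e partnerAK.
have noblock s u : rankA s (sg u) < rankA s (sg s) ->
    pB (kB (sg u)) (kA s) (kA u) -> False.
  move=> lt p; apply: stM; exists (kA s), (kB (sg u)); split.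
  - by rewrite sgE; apply: contraTneq lt => /kB_inj ->; rewrite ltnn.
  - by apply: pref_of_rank_lt; rewrite !kAK !kBK.
  - by rewrite -sgE partnerAK sgE.
(* If d_0 left c_0 for t, the top-choice agent of t would block. *)
have sgN : sg None = None.
  apply/eqP/negP => /negP t0; apply: (noblock (sg None) None); last exact: own.
  rewrite ltnNge; apply/negP => /rankA_top[/eqP|/sg_inj/eqP].
    by rewrite (negbTE t0).
  by rewrite (negbTE t0).
have mania s : s != None -> rankA s None < rankA s (sg s) -> False.
  by move=> s0 lt; apply: (noblock s None); rewrite sgN //; apply: last0.
have sg_neqN s : s != None -> sg s != None.
  by apply: contra_neq => e; apply: sg_inj; rewrite sgN.
have sg_filler k : sg (filler k) = filler k.
  apply/eqP/negP => /negP ne; apply: (mania (filler k)) => //=.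
  by rewrite (negbTE ne) (negbTE (sg_neqN _ _)).
have sg_seeker i : sg (seeker i) = seeker i.
  apply/eqP/negP => /negP ne; apply: (noblock (seeker i) (filler (g i)));
    rewrite sg_filler; last exact: needle.
  (* The fillers keep all c_k, so a displaced a_i gets a partner of rank at least 2, worse than c_(g
     i). *)
  rewrite /= (negbTE ne); case e: (sg _) => [[k|t]|] //; last by case: ifP.
  by have := sg_filler k; rewrite -[RHS]e => /sg_inj.
have sg_rival i : sg (rival i) = rival i.
  apply/eqP/negP => /negP ne; apply: (mania (rival i)) => //=.
  rewrite (negbTE ne) (negbTE (sg_neqN _ _)) //; case: eqP => // e.
  by have := sg_seeker i; rewrite -[RHS]e => /sg_inj.
have sg_id s : sg s = s.
  by case: s => [[k|[i|i]]|]; [exact: sg_filler | exact: sg_seeker |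
    exact: sg_rival | exact: sgN].
by rewrite -[in RHS](sg_id (hB y)) -sgE partnerAK.
Qed.

(** * Queries that every proof must contain *)

Lemma swapped_stable g i : g i = None -> stable instA (instB g) (swapped i).
Proof.
move=> gi [x [y [ne]]]; rewrite -[x]hAK -[y]hBK /= !kAK kBK => xy yx.
have {}ne : hB y != tperm (seeker i) (rival i) (hA x).
  by apply: contra_neq ne => e; rewrite -[y]hBK e.
have := pref_of_rank_le xy; have := pref_of_rank_le yx.
rewrite !kAK !kBK => {xy yx}; move: (hA x) (hB y) ne => s t.
(* Apart from d_0, only a_i and e_i lose their first choice. e_i prefers only f_i, who holds its
   favourite a_i; a_i prefers b_i, who holds its favourite e_i, and the c_k, who prefer d_k as
   [g i = None]. Nobody in B prefers d_0 to its partner. *)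
case: tpermP => [->|->|sn1 sn2]; last first.
- move=> ts lt /rankA_top[sN|/eqP]; last by rewrite (negbTE ts).
  move: lt; rewrite sN.
  case: tpermP => [->|->|_ _]; rewrite /= ?eqxx //.
  move: ts; rewrite sN => t0; rewrite leqNgt rankB_None //.
- rewrite /= => tS; case: ifP => [/eqP->|_]; rewrite ?(negbTE tS) ?eqxx //.
    by rewrite tpermR /= !eqxx.
  by case: ifP.
- rewrite /= => tR; case: t tR => [[k|[j|j]]|] tR; rewrite ?(negbTE tR).
  + rewrite tpermD //= gi /= ?eqxx //.
  + case: ifP => [/eqP[->]|_ _]; last by rewrite eqxx.
    by rewrite tpermL /= !eqxx.
  + by rewrite eqxx.
  + by rewrite eqxx.
Qed.

(** Forgetting which c_k is asked makes counting easy: a query names at most two agents of A, so it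
    probes at most two seekers. *)
Definition probes i (q : query A B) :=
  (q.1.2 == kA (seeker i)) || (q.2 == kA (seeker i)).

Definition touches i (y : B) (q : query A B) := (q.1.1 == y) && probes i q.

(** The value [g i] influences nothing but the rank of a_i at c_(g i). *)
Lemma instB_answer g g' i q :
  (forall j, j != i -> g j = g' j) ->
  (forall k, g i = Some k \/ g' i = Some k -> ~~ touches i (kB (filler k)) q) ->
  answer (instB g) q = answer (instB g') q.
Proof.
case: q => [[y x1] x2] gg' nt /=.
have e x : (x == x1) || (x == x2) -> rankB g (hB y) (hA x) = rankB g' (hB y) (hA x).
  move=> xx; case yE: (hB y) => [[k|[j|j]]|] //=.
  case xE: (hA x) => [[?|[j|?]]|] //=.
  have [ji|/gg' -> //] := eqVneq j i; rewrite ji in xE.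
  have tk : touches i (kB (filler k)) (y, x1, x2).
    rewrite /touches /probes; have -> : kA (seeker i) = x by rewrite -[x]hAK xE.
    have -> : kB (filler k) = y by rewrite -[y]hBK yE.
    by rewrite /= eqxx ![_ == x]eq_sym.
  have := nt k; rewrite tk ji => ntk.
  have /negbTE -> : g i != Some k by apply/eqP => h; case/negP: (ntk (or_introl h)).
  by have /negbTE -> : g' i != Some k by apply/eqP => h; case/negP: (ntk (or_intror h)).
rewrite /instB (pref_of_rank_eq (r' := fun x => rankB g' (hB y) (hA x))) //.
  by apply: e; rewrite eqxx.
by apply: e; rewrite eqxx orbT.
Qed.

Lemma proves_touches g (Q : pred (query A B)) M i :
  proves instA (instB (Some \o g)) Q M ->
  exists2 q, Q q & touches i (kB (filler (g i))) q.
Proof.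
move=> prQ; apply: contrapT => nex.
pose g' j := if j == i then None else Some (g j).
have bestM : B_optimal instA (instB (Some \o g)) M by apply: prQ.
have [stD optD] : B_optimal instA (instB (Some \o g)) diagonal.
  exact: certificate_proves.
have [_ opt'] : B_optimal instA (instB g') M.
  apply: prQ => q Qq; apply: (@instB_answer _ _ i).
    by move=> j ji; rewrite /g' (negbTE ji).
  rewrite {1}/g' eqxx => k []// [<-]; apply/negP => t; apply: nex.
  by exists q.
have g'i : g' i = None by rewrite /g' eqxx.
(* Two B-optimal matchings are weakly preferred to each other, so they coincide. *)
have MD y : partnerB M y = partnerB diagonal y.
  have [//|p] := bestM.2 _ stD y.
  have [//|p'] := optD M bestM.1 y.
  by case: (pref_asym p p').
have := opt' _ (swapped_stable g'i) (kB (seeker i)).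
rewrite MD /= kBK tpermL => -[/(can_inj kAK)//|/pref_of_rank_le].
by rewrite !kAK kBK /= !eqxx.
Qed.

Lemma opt_gt0 (g : 'I_m -> 'I_K) :
  0 < m -> 0 < opt instA (instB (Some \o g)).
Proof.
move=> m_gt0; apply: (big_ind (fun k => 0 < k)).
(* The default value of the minimum must be positive as well. *)
- by apply/card_gt0P; exists (kB None, kA None, kA None).
- by move=> x y; rewrite leq_min => -> ->.
- move=> Q /asboolP[M prQ].
  have [q Qq _] := proves_touches (Ordinal m_gt0) prQ.
  by apply/card_gt0P; exists q.
Qed.

Lemma opt_le (g : 'I_m -> 'I_K) :
  opt instA (instB (Some \o g)) <= #|B| + #|A| + m.
Proof.
apply: (@bigmin_inf _ nat _ _ (certificate g)); last exact: card_certificate.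
by apply/asboolP; exists diagonal; apply: certificate_proves.
Qed.

(** * The average cost of searching for the hidden function *)

Definition updated (g : 'I_m -> option 'I_K) i v j := if j == i then v else g j.

(* Until the pair (c_k, a_i) is queried, the run with g i = k agrees with the run
   in which no c_k likes a_i, and one query settles at most one k, so the costs
   over S are at least 1, 2, ..., |S|. *)
Lemma search_cost (t : strategy A B) g i (S : {set 'I_K}) :
  (forall k, k \in S -> has (touches i (kB (filler k)))
                         (queries t (instB (updated g i (Some k))))) ->
  #|S| * #|S|.+1 <=
  2 * \sum_(k in S) count (probes i) (queries t (instB (updated g i (Some k)))).
Proof.
elim: t S => [M|q next IH] S hS.
  have [->|[k /hS//]] := set_0Vmem S.
  by rewrite cards0.
pose z := answer (instB (updated g i None)) q.
have step k : ~~ touches i (kB (filler k)) q ->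
    answer (instB (updated g i (Some k))) q = z.
  move=> nt; apply: (@instB_answer _ _ i) => [j ji|k'].
    by rewrite /updated (negbTE ji).
  by rewrite /updated eqxx => -[[<-]|].
have IHz (S' : {set 'I_K}) : S' \subset S ->
    (forall k, k \in S' -> ~~ touches i (kB (filler k)) q) ->
    #|S'| * #|S'|.+1 <= 2 * \sum_(k in S')
      count (probes i) (queries (next z) (instB (updated g i (Some k)))).
  move=> /fintype.subsetP sub nt; apply: IH => k kS'.
  by have := hS k (sub _ kS'); rewrite /= (negbTE (nt k kS')) (step k (nt k kS')).
(* A first query touching no candidate leaves [S] as it is. Otherwise it touches exactly one, [k0],
   since it asks a single agent of B; it then adds one to the cost of each k in [S], and the
   induction continues without [k0]. *)
have [/existsP[k0 /andP[k0S tk0]]|/existsPn none] :=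
    boolP [exists k, (k \in S) && touches i (kB (filler k)) q]; last first.
  have nt k : k \in S -> ~~ touches i (kB (filler k)) q.
    by move=> kS; have := none k; rewrite kS.
  apply: leq_trans (IHz S (subxx _) nt) _; rewrite leq_mul2l /=.
  by apply: leq_sum => k kS; rewrite step ?nt // leq_addl.
have pq : probes i q by case/andP: tk0.
have nt k : k \in S :\ k0 -> ~~ touches i (kB (filler k)) q.
  rewrite !inE => /andP[kk0 _]; apply: contra kk0 => /andP[/eqP e _].
  case/andP: tk0 => /eqP; rewrite e => /(can_inj kBK)[->] _.
  exact: eqxx.
move: (IHz _ (subD1set S k0) nt); set rest := (\sum_(k in _) _) => IHS.
rewrite (big_setD1 k0) //= pq (cardsD1 k0 S) k0S add1n.
rewrite [X in _ <= 2 * (_ + X)](eq_bigr (fun k => 1 + count (probes i)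
  (queries (next z) (instB (updated g i (Some k)))))); last first.
  by move=> k kS; rewrite step ?nt.
rewrite big_split /= -/rest.
have -> : \sum_(k in S :\ k0) 1 = #|S :\ k0| by rewrite sum1_card.
clearbody rest; move: IHS; move: #|_| (count _ _) => c x.
clear; nia.
Qed.

Definition updatef (g : {ffun 'I_m -> 'I_K}) i k : {ffun 'I_m -> 'I_K} :=
  [ffun j => if j == i then k else g j].

(** Redrawing one value of a uniformly random g leaves it uniform. *)
Lemma sum_updatef (F : {ffun 'I_m -> 'I_K} -> nat) i :
  \sum_g \sum_k F (updatef g i k) = K * \sum_g F g.
Proof.
rewrite pair_big /=.
(* [(g, k) |-> (g with i mapped to k, g i)] is an involution. *)
rewrite (reindex_inj (h := fun p => (updatef p.1 i p.2, p.1 i))) /=; last first.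
  apply: inv_inj => -[g k] /=; rewrite /updatef ffunE eqxx; congr pair.
  by apply/ffunP => j; rewrite !ffunE; case: eqP => [->|].
rewrite -(pair_big xpredT xpredT (fun g k => F (updatef (updatef g i k) i (g i)))) /=.
rewrite big_distrr /=; apply: eq_bigr => g _.
rewrite (eq_bigr (fun=> F g)) => [|k _]; first by rewrite sum_nat_const card_ord.
by congr F; apply/ffunP => j; rewrite !ffunE; case: eqP => [->|].
Qed.

Lemma sum_eq_le1 (x : A) : \sum_i (x == kA (seeker i)) <= 1.
Proof.
rewrite -big_mkcond /= sum1_card; apply/card_le1_eqP => i j.
by rewrite !unfold_in => /eqP-> /eqP/(can_inj kAK)[].
Qed.

Lemma sum_probes (s : seq (query A B)) :
  \sum_i count (probes i) s <= 2 * size s.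
Proof.
elim: s => [|q s IH] /=; first by rewrite big1.
rewrite big_split mulnS leq_add //=.
apply: leq_trans (leq_add (sum_eq_le1 q.1.2) (sum_eq_le1 q.2)).
by rewrite -big_split leq_sum // => i _; rewrite /probes; case: eqP; case: eqP.
Qed.

Lemma sum_queries (t : strategy A B) : 0 < K ->
  (forall g, proves instA (instB g) (mem (queries t (instB g)))
                    (output t (instB g))) ->
  K ^ m * (m * K.+1) <=
  4 * \sum_(g : {ffun 'I_m -> 'I_K}) size (queries t (instB (Some \o g))).
Proof.
move=> K_gt0 correct.
pose N i (g : {ffun 'I_m -> 'I_K}) :=
  count (probes i) (queries t (instB (Some \o g))).
have cost_i i : K ^ m * K.+1 <= 2 * \sum_g N i g.
  rewrite -(leq_pmul2l K_gt0) [leqRHS]mulnCA -(sum_updatef _ i) big_distrr /=.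
  have <- : #|{ffun 'I_m -> 'I_K}| = K ^ m by rewrite card_ffun !card_ord.
  rewrite mulnCA -sum_nat_const.
  apply: leq_sum => g _; have := @search_cost t (Some \o g) i [set: 'I_K]%SET.
  have upd k : updated (Some \o g) i (Some k) = Some \o updatef g i k.
    by apply/funext => j; rewrite /updated /= ffunE; case: eqP.
  rewrite cardsT card_ord => bound; apply: leq_trans (bound _) _ => [k _|].
    have := proves_touches i (correct (Some \o updatef g i k)).
    rewrite ffunE eqxx upd => -[q qQ tq].
    by apply/hasP; exists q.
  rewrite leq_mul2l /= big_mkcond.
  by apply: leq_sum => k _; rewrite inE upd.
have : \sum_(i < m) (K ^ m * K.+1) <= \sum_i (2 * \sum_g N i g) by apply: leq_sum.
rewrite sum_nat_const card_ord mulnCA => /leq_trans -> //.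
(* One factor 2 comes from the triangular number in [search_cost], the other from the two agents of
   A named in a query. *)
rewrite -big_distrr exchange_big /= -[4]/(2 * 2) -mulnA leq_mul2l /=.
by rewrite big_distrr leq_sum // => g _; apply: sum_probes.
Qed.

End HardInstance.

(** * From total cost over a finite family to the competitive ratio *)

Lemma competitive_ratio_ge_mean (R : realType) (A B I : finType) (D : nat)
    (x : R) (cost : (A -> pref B) -> (B -> pref A) -> \bar R)
    (pA : A -> pref B) (pB : I -> B -> pref A) :
  (0 < #|I|)%N ->
  (forall i, 0 < opt pA (pB i) <= D)%N ->
  (forall i, 0 <= cost pA (pB i))%E ->
  (x%:E <= \sum_i cost pA (pB i))%E ->
  ((x / (#|I| * D)%:R)%:E <= competitive_ratio cost)%E.
Proof.
move=> /card_gt0P[i0 _] optD cost_ge0 sum_ge.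
set r := competitive_ratio cost.
have le_r i : (cost pA (pB i) * ((opt pA (pB i))%:R^-1)%:E <= r)%E.
  by apply: ereal_sup_ubound; exists pA, (pB i); case/andP: (optD i).
have r_ge0 : (0 <= r)%E.
  by apply: le_trans (le_r i0); rewrite mule_ge0 // lee_fin invr_ge0.
(* Yao's averaging argument: a finite ratio [r] bounds each cost by [r * D], hence the total by
   [#|I| * D * r]. *)
case: r le_r r_ge0 => [r| |] // le_r r_ge0; last by rewrite leey.
have cost_le i : (cost pA (pB i) <= (r * D%:R)%:E)%E.
  have /andP[opt_pos optleD] := optD i.
  have := le_r i; rewrite lee_pdivrMr ?ltr0n // => /le_trans; apply.
  by rewrite -EFinM lee_fin ler_wpM2l ?ler_nat.
have D_gt0 : (0 < #|I| * D)%N.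
  by rewrite muln_gt0; apply/andP; split;
    [apply/card_gt0P; exists i0 | case/andP: (optD i0) => /leq_trans; apply].
rewrite lee_fin ler_pdivrMr ?ltr0n //.
rewrite -lee_fin (le_trans sum_ge) //.
apply: le_trans (lee_sum _ (fun i _ => cost_le i)) _.
by rewrite sumEFin lee_fin sumr_const -[leLHS]mulr_natr natrM mulrA mulrAC.
Qed.

(** The bound holds for each seed, so it survives integration, and expectation is additive. *)
Lemma expected_cost_sum (d : measure_display) (Omega : measurableType d)
    (R : realType) (P : probability Omega R) (A B I : finType) (x : R)
    (alg : randomized_algorithm A B Omega R) pA (pB : I -> B -> pref A) :
  0 <= x ->
  (forall w, x <= \sum_i (num_queries (alg w) pA (pB i))%:R) ->
  (x%:E <= \sum_i expected_cost P alg pA (pB i))%E.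
Proof.
move=> x0 le_x; rewrite /expected_cost.
have meas i : measurable_fun [set: Omega]
    (EFin \o (fun w => (num_queries (alg w) pA (pB i))%:R : R)).
  by apply/measurable_EFinP; apply: seeded_measurable.
rewrite (eq_bigr (fun i => \int[P]_w (num_queries (alg w) pA (pB i))%:R%:E)%E);
  last by move=> i _; rewrite unlock.
rewrite -(ge0_integral_sum P measurableT meas); last first.
  by move=> i w _; rewrite /= lee_fin.
rewrite -[leLHS]mule1 -(probability_setT P) -integral_cst //.
apply: ge0_le_integral => //=.
- by apply: emeasurable_sum.
- by move=> w _; rewrite sumEFin lee_fin.
Qed.

Lemma card_eq_bij (A T : finType) :
  #|A| = #|T| -> exists (f : A -> T) (h : T -> A), cancel f h /\ cancel h f.
Proof.
move=> e; exists (fun x => enum_val (cast_ord e (enum_rank x))).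
exists (fun y => enum_val (cast_ord (esym e) (enum_rank y))).
by split=> x; rewrite enum_valK ?cast_ordK ?cast_ordKV enum_rankK.
Qed.

Theorem theorem10 (R : realType) :
  exists (c : R) (N : nat), 0 < c /\
    forall (n : nat) (A B : finType),
      (N <= n)%N -> #|A| = n -> #|B| = n ->
      (forall alg : algorithm A B,
         finds_B_optimal alg ->
         ((c * n%:R)%:E <= competitive_ratio (det_cost R alg))%E)
      /\
      (forall (d : measure_display) (Omega : measurableType d)
              (P : probability Omega R)
              (alg : randomized_algorithm A B Omega R),
         (forall w : Omega, finds_B_optimal (alg w)) ->
         ((c * n%:R)%:E <= competitive_ratio (expected_cost P alg))%E).
Proof.
(* With [m >= n / 8], [K + 1 >= n / 2] and [opt <= 3 * n], the mean ratio is at least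
   [m * (K + 1) / (4 * 3 * n) >= n / 192]. *)
exists (192%:R^-1), 16; split; first by rewrite invr_gt0 ltr0n.
move=> n A B n16 cardA cardB.
pose m := (n %/ 4)%N; pose K := (n - 1 - 2 * m)%N.
have m_gt0 : (0 < m)%N by rewrite /m; lia.
have K_gt0 : (0 < K)%N by rewrite /K /m; lia.
have cardT : #|{: option ('I_K + ('I_m + 'I_m))}| = n.
  by rewrite card_option !card_sum !card_ord /K /m; lia.
have [hA [kA [hAK kAK]]] := card_eq_bij (etrans cardA (esym cardT)).
have [hB [kB [hBK kBK]]] := card_eq_bij (etrans cardB (esym cardT)).
pose pA := instA hA hB.
pose pB (g : {ffun 'I_m -> 'I_K}) := instB hA hB (Some \o g).
pose x : R := (K ^ m * (m * K.+1))%:R / 4%:R.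
have x0 : 0 <= x by rewrite divr_ge0.
have cardG : #|{ffun 'I_m -> 'I_K}| = (K ^ m)%N by rewrite card_ffun !card_ord.
have cardG_gt0 : (0 < #|{ffun 'I_m -> 'I_K}|)%N by rewrite cardG expn_gt0 K_gt0.
have opt_bounds g : (0 < opt pA (pB g) <= 3 * n)%N.
  rewrite (opt_gt0 hAK kAK hBK kBK) //=.
  apply: leq_trans (opt_le hAK kAK hBK kBK g) _.
  by rewrite cardA cardB /m; lia.
have total (alg : algorithm A B) : finds_B_optimal alg ->
    x <= \sum_g (num_queries alg pA (pB g))%:R.
  move=> correct; rewrite ler_pdivrMr ?ltr0n // -natr_sum -natrM ler_nat [leqRHS]mulnC.
  by apply: (sum_queries hAK kAK hBK kBK) => // g; apply: correct.
have bound : 192%:R^-1 * n%:R <= x / (#|{ffun 'I_m -> 'I_K}| * (3 * n))%:R.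
  have n_gt0 : (0 < n)%N by lia.
  rewrite cardG ler_pdivlMr ?ltr0n ?muln_gt0 ?expn_gt0 ?K_gt0 ?n_gt0 //.
  rewrite /x ler_pdivlMr ?ltr0n // -2!mulrA ler_pdivrMl ?ltr0n //.
  rewrite -!natrM ler_nat [leqRHS]mulnCA -!mulnA mulnCA leq_mul2l.
  have Kn : (n <= 2 * K.+1)%N by rewrite /K /m; lia.
  have mn : (n <= 8 * m)%N by rewrite /m; lia.
  have := leq_mul mn Kn; move: (K) (m) => k l; clear; nia.
split=> [alg correct|d Omega P alg correct].
  apply: le_trans (competitive_ratio_ge_mean _ opt_bounds _ _); rewrite ?lee_fin.
  - exact: bound.
  - exact: cardG_gt0.
  - by move=> g; rewrite /det_cost lee_fin.
  - by rewrite /det_cost sumEFin lee_fin; apply: total.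
apply: le_trans (competitive_ratio_ge_mean _ opt_bounds _ _); rewrite ?lee_fin.
- exact: bound.
- exact: cardG_gt0.
- by move=> g; apply: expectation_ge0.
- by apply: expected_cost_sum => // w; apply: total.
Qed.
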